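(* Let $B$ be a topological space and $D$ a nonempty set. Every sheaf-valued structure over $B$ with domain $D$ is a model of first-order intuitionistic predicate logic, and every presheaf-valued structure over $B$ with domain $D$ is a model of first-order intuitionistic predicate logic.
   Context: Language: first-order language with individual variables, countably many predicate variables of each arity $n\ge 0$, no function symbols or constants, connectives $\bot,\land,\lor,\to$, quantifiers $\exists,\forall$; $\neg\alpha$ abbreviates $\alpha\to\bot$. Presheaves: a presheaf on $B$ is a functor $F$ from the category of open subsets of $B$ (with inclusions) to sets; elements of $F(U)$ are sections over $U$. Morphisms are natural transformations. For presheaves $F_i$: product $(\prod F_i)(U)=\prod_i F_i(U)$, coproduct $(\bigsqcup F_i)(U)=\bigsqcup_i F_i(U)$; $\mathrm{Hom}(F,G)(U)$ is the set of presheaf morphisms $F|_U\to G|_U$ with restriction of morphisms; $\mathrm{Char}\,\emptyset$ is the presheaf with $(\mathrm{Char}\,\emptyset)(\emptyset)$ a one-point set and $(\mathrm{Char}\,\emptyset)(V)=\emptyset$ for $V\neq\emptyset$. Sheaves: a sheaf on $B$ is a local homeomorphism $\mathcal F\colon E\to B$; a section over open $U$ is a continuous $s\colon U\to E$ with $\mathcal F s=\mathrm{id}_U$; $\sigma\mathcal F$ is its presheaf of sections; for a presheaf $F$, $\gamma F$ is its sheaf of germs (sheafification). For sheaves: $\prod\mathcal F_i=\gamma\prod\sigma\mathcal F_i$, $\bigsqcup\mathcal F_i=\gamma\bigsqcup\sigma\mathcal F_i$ (the disjoint union of total spaces), $\mathrm{Hom}(\mathcal F,\mathcal G)=\gamma\,\mathrm{Hom}(\sigma\mathcal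 F,\sigma\mathcal G)$, and $\chi_\emptyset=\gamma\,\mathrm{Char}\,\emptyset$ is the empty sheaf. A sheaf-valued (resp. presheaf-valued) structure over $B$ with domain $D$ assigns to each $n$-ary predicate variable $P$ and each $(d_1,\dots,d_n)\in D^n$ a sheaf (resp. presheaf) $|P|(d_1,\dots,d_n)$ on $B$. Given a valuation $\mu$ of individual variables in $D$, each formula $\phi$ gets a sheaf (resp. presheaf) $|\phi|_\mu$ by: atomic formulas as assigned; $|\alpha\lor\beta|=|\alpha|\sqcup|\beta|$; $|\alpha\land\beta|=|\alpha|\times|\beta|$; $|\alpha\to\beta|=\mathrm{Hom}(|\alpha|,|\beta|)$; $|\bot|=\chi_\emptyset$ (resp. $\mathrm{Char}\,\emptyset$); $|\exists x\,\alpha(x)|_\mu=\bigsqcup_{d\in D}|\alpha|_{\mu[x\mapsto d]}$; $|\forall x\,\alpha(x)|_\mu=\prod_{d\in D}|\alpha|_{\mu[x\mapsto d]}$, using the sheaf (resp. presheaf) operations. A formula $\phi$ is valid in the structure if $|\phi|_\mu$ has a global section (a section over $B$, resp. $|\phi|_\mu(B)\ne\emptyset$) for every valuation $\mu$. A structure is a model of intuitionistic predicate logic if whenever $\psi$ is derivable in intuitionistic (Heyting) predicate calculus from hypotheses $\phi_1,\dots,\phi_k$ (modus ponens and the generalization rule $\alpha(x)/\forall x\,\alpha(x)$ being allowed also on variables free in hypotheses) and each $\phi_i$ is valid in the structure, then $\psi$ is valid in the structure; in particular every theorem of intuitionistic predicate logic is valid.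
   Formalization: For presheaf-valued structures it is assumed that each |P|(d_1,…,d_n) has a section over the empty set; without this ⊥→P fails (e.g. if |P| is the constantly empty presheaf), and the condition is necessary for the structure to be a model. *)

(* Defs.v *)
From HB Require Import structures.
From mathcomp Require Import all_boot all_classical topology.

Set Implicit Arguments.
Unset Strict Implicit.
Unset Printing Implicit Defensive.

Local Open Scope classical_set_scope.

(** * Presheaves *)

Record opens (B : topologicalType) :=
  Opens { oset :> set B; opens_open : open oset }.

Definition opens0 (B : topologicalType) : opens B := Opens (@open0 B).
Definition opensT (B : topologicalType) : opens B := Opens (@openT B).
Definition opensI (B : topologicalType) (U V : opens B) : opens B :=
  Opens (openI (opens_open U) (opens_open V)).

Record presheaf (B : topologicalType) := Presheaf {
  sect :> opens B -> Type;
  res : forall U V : opens B, V `<=` U -> sect U -> sect V;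
  res_id : forall (U : opens B) (h : U `<=` U) (s : sect U), res h s = s;
  res_comp : forall (U V W : opens B) (h : V `<=` U) (k : W `<=` V)
    (l : W `<=` U) (s : sect U), res k (res h s) = res l s }.

Section PresheafOperations.
Variable B : topologicalType.
Implicit Types (U V W : opens B) (F G : presheaf B).

Definition psh_prod (I : Type) (F : I -> presheaf B) : presheaf B.
Proof.
refine (@Presheaf B (fun U => forall i, F i U)
  (fun U V h s i => res h (s i)) _ _).
- by move=> U h s; apply: functional_extensionality_dep => i; exact: res_id.
- move=> U V W h k l s; apply: functional_extensionality_dep => i.
  exact: res_comp.
Defined.

Definition psh_coprod (I : Type) (F : I -> presheaf B) : presheaf B.
Proof.
refine (@Presheaf B (fun U => {i : I & F i U})
  (fun U V h s => existT (fun i => F i V) (projT1 s) (res h (projT2 s))) _ _).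
- by move=> U h [i s] /=; rewrite res_id.
- by move=> U V W h k l [i s] /=; rewrite (res_comp h k l).
Defined.

(* A morphism F|_U -> G|_U; the open subsets of the subspace U are the open
   subsets of B contained in U. *)
Record mor (F G : presheaf B) (U : opens B) := Mor {
  mor_fun :> forall V, V `<=` U -> F V -> G V;
  mor_nat : forall V W (h : V `<=` U) (k : W `<=` U) (l : W `<=` V) (s : F V),
    res l (mor_fun h s) = mor_fun k (res l s) }.

Lemma mor_eq F G U (f g : mor F G U) :
  (forall V (h : V `<=` U) (s : F V), f V h s = g V h s) -> f = g.
Proof.
case: f g => [f fn] [g gn] /= fg.
have {}fg : f = g.
  apply: functional_extensionality_dep => V.
  by apply: functional_extensionality_dep => h; apply/funext => s; exact: fg.
by case: _ / fg gn => gn; congr Mor; exact: Prop_irrelevance.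
Qed.

Definition mor_res F G U V (h : V `<=` U) (f : mor F G U) : mor F G V.
Proof.
refine (@Mor F G V (fun W k s => f W (subset_trans k h) s) _).
by move=> W X k k' l s; exact: mor_nat.
Defined.

Definition psh_hom F G : presheaf B.
Proof.
refine (@Presheaf B (mor F G) (@mor_res F G) _ _).
- move=> U h f; apply: mor_eq => V k s /=.
  by congr (f V _ s); exact: Prop_irrelevance.
- move=> U V W h k l f; apply: mor_eq => X m s /=.
  by congr (f X _ s); exact: Prop_irrelevance.
Defined.

(* Char of the empty set: one point over the empty set, no section elsewhere. *)
Definition psh_char0 : presheaf B.
Proof.
refine (@Presheaf B (fun V => {_ : unit | V = set0 :> set B})
  (fun U V h s => exist _ tt _) _ _).
- by move=> U h [[] e]; exact: eq_exist.
- by move=> *; exact: eq_exist.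
Unshelve.
by case: s => _ e; apply/seteqP; split=> //; rewrite -e.
Defined.

End PresheafOperations.

(** * Sheaves *)

(* p restricts to a homeomorphism of an open neighbourhood of each point onto
   an open set; g is the inverse homeomorphism, extended arbitrarily. *)
Definition local_homeomorphism (E B : topologicalType) (p : E -> B) : Prop :=
  forall e : E, exists O : set E,
    [/\ open O, O e, open (p @` O), {within O, continuous p} &
      exists2 g : B -> E,
        {within p @` O, continuous g} & forall x, O x -> g (p x) = x].

Record sheaf (B : topologicalType) := Sheaf {
  total : topologicalType;
  proj : total -> B;
  proj_lh : local_homeomorphism proj }.

Section Sections.
Variables (B : topologicalType) (F : sheaf B).
Implicit Types U V W : opens B.

(* [U] as a type carries the subspace topology. *)
Record shsection U := ShSection {
  sfun :> U -> total F;
  sfun_continuous : continuous sfun;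
  sfunK : forall x : U, proj (sfun x) = val x }.

Lemma shsection_eq U (s t : shsection U) : (forall x, s x = t x) -> s = t.
Proof.
case: s t => [s cs sK] [t ct tK] /= /funext st.
by case: _ / st ct tK => ct tK; congr ShSection; exact: Prop_irrelevance.
Qed.

Definition set_incl (U V : set B) (h : V `<=` U) (x : V) : U :=
  SigSub (mem_set (h _ (set_valP x))).

Lemma set_incl_continuous (U V : set B) (h : V `<=` U) :
  continuous (set_incl h).
Proof.
apply: continuous_comp_initial => x; exact: initial_continuous.
Qed.

Definition shsection_res U V (h : V `<=` U) (s : shsection U) : shsection V.
Proof.
refine (@ShSection V (s \o set_incl h) _ _).
- move=> x; apply: continuous_comp; first exact: set_incl_continuous.
  exact: sfun_continuous.
- by move=> x; rewrite /= sfunK.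
Defined.

Definition sigma : presheaf B.
Proof.
refine (@Presheaf B shsection shsection_res _ _).
- move=> U h s; apply: shsection_eq => x /=.
  by congr (s _); apply: val_inj.
- move=> U V W h k l s; apply: shsection_eq => x /=.
  by congr (s _); apply: val_inj.
Defined.

End Sections.

(** * The sheaf of germs of a presheaf *)

Section Germs.
Variables (B : topologicalType) (F : presheaf B).
Implicit Types U V W : opens B.

Record local_section (x : B) :=
  LocalSection { ls_dom : opens B; ls_in : oset ls_dom x; ls_sec : F ls_dom }.

Definition germ_rel (x : B) (r r' : local_section x) : Prop :=
  exists W : opens B, oset W x /\
    exists (h : W `<=` ls_dom r) (h' : W `<=` ls_dom r'),
      res h (ls_sec r) = res h' (ls_sec r').

Definition stalk (x : B) : Type :=
  {C : set (local_section x) | exists r, C = germ_rel r}.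

Definition germs : Type := {x : B & stalk x}.

Definition germ_at U (s : F U) (x : B) (Ux : oset U x) : germs :=
  existT stalk x (exist _ _ (ex_intro _ (LocalSection Ux s) erefl)).

Definition germ_image U (s : F U) : set germs :=
  [set g | exists (x : B) (Ux : oset U x), g = germ_at s Ux].

Lemma germ_rel_refl x (r : local_section x) : germ_rel r r.
Proof. by case: r => U Ux s; exists U; split => //; do 2!exists (@subset_refl _ U). Qed.

Lemma germ_rel_sym x (r r' : local_section x) : germ_rel r r' -> germ_rel r' r.
Proof. by move=> [W [Wx [h [h' e]]]]; exists W; split => //; exists h', h. Qed.

Lemma germ_rel_trans x (r1 r2 r3 : local_section x) :
  germ_rel r1 r2 -> germ_rel r2 r3 -> germ_rel r1 r3.
Proof.
move=> [W [Wx [h1 [h2 e]]]] [W' [Wx' [h2' [h3 e']]]].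
exists (opensI W W'); split => //.
have k : opensI W W' `<=` W by move=> ? [].
have k' : opensI W W' `<=` W' by move=> ? [].
exists (subset_trans k h1), (subset_trans k' h3).
rewrite -(res_comp h1 k) e -(res_comp h3 k') -e'.
by rewrite (res_comp h2 k (subset_trans k h2)) (res_comp h2' k' (subset_trans k h2)).
Qed.

Lemma germ_atP U V (s : F U) (t : F V) x (Ux : oset U x) (Vx : oset V x) :
  germ_at s Ux = germ_at t Vx <->
  exists W : opens B, oset W x /\
    exists (h : W `<=` U) (h' : W `<=` V), res h s = res h' t.
Proof.
split => [e|e].
  have e1 : germ_rel (LocalSection Ux s) = germ_rel (LocalSection Vx t).
    pose f (g : germs) : set (local_section x) :=
      [set r | exists h : projT1 g = x,
         sval (projT2 g) (eq_rect_r local_section r h)].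
    have fE W (u : F W) (Wx : oset W x) :
        f (germ_at u Wx) = germ_rel (LocalSection Wx u).
      apply/seteqP; split => r /=.
        by case=> h; rewrite (Prop_irrelevance h erefl).
      by move=> rr; exists erefl.
    by rewrite -!fE e.
  have := germ_rel_refl (LocalSection Vx t).
  by rewrite -[X in X -> _]/(germ_rel _ _) -{1}e1.
congr existT; apply: eq_exist; apply/seteqP; split => r rr.
  by apply: germ_rel_trans rr; apply: germ_rel_sym.
by apply: germ_rel_trans rr.
Qed.

Lemma germs_surj (g : germs) :
  exists U (s : F U) (x : B) (Ux : oset U x), g = germ_at s Ux.
Proof.
case: g => x [C [[U Ux s] eC]]; exists U, s, x, Ux.
by congr existT; apply: eq_exist.
Qed.

Lemma germ_at_res U V (h : V `<=` U) (s : F U) x (Vx : oset V x) (Ux : oset U x) :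
  germ_at (res h s) Vx = germ_at s Ux.
Proof.
apply/germ_atP; exists V; split => //; exists (@subset_refl _ V), h.
by rewrite res_id.
Qed.

(* The topology with basis the sets [germ_image s]. *)
Definition germ_open : set_system germs :=
  [set O | forall g, O g ->
     exists U (s : F U), germ_image s g /\ germ_image s `<=` O].

Lemma germ_openT : germ_open setT.
Proof.
move=> g _; have [U [s [x [Ux ->]]]] := germs_surj g.
by exists U, s; split => //; exists x, Ux.
Qed.

Lemma germ_openI : setI_closed germ_open.
Proof.
move=> O O' oO oO' _ [/oO[U [s [[x [Ux ->]] sO]]] /oO'[V [t [[y [Vy e]] tO']]]].
have xy : x = y by exact: (congr1 (@projT1 _ _) e).
subst y; have /germ_atP [W [Wx [h [h' st]]]] := e.
exists W, (res h s); split; first by exists x, Wx; rewrite (germ_at_res _ _ _ Ux).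
move=> _ [y [Wy ->]]; split.
  by apply: sO; exists y, (h _ Wy); exact: germ_at_res.
by apply: tO'; exists y, (h' _ Wy); rewrite st; exact: germ_at_res.
Qed.

Lemma germ_open_bigU (I : Type) (f : I -> set germs) :
  (forall i, germ_open (f i)) -> germ_open (\bigcup_i f i).
Proof.
move=> fo g [i _ /fo[U [s [gs sf]]]]; exists U, s; split => //.
by apply: subset_trans sf _; exact: bigcup_sup.
Qed.

HB.instance Definition _ := gen_eqMixin germs.
HB.instance Definition _ := gen_choiceMixin germs.
HB.instance Definition _ :=
  isOpenTopological.Build germs germ_openT germ_openI germ_open_bigU.

Definition germ_pt (g : germs) : B := projT1 g.

Lemma open_germsE : @open germs = germ_open. Proof. by []. Qed.

Lemma open_germ_image U (s : F U) : open (germ_image s).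
Proof. by rewrite open_germsE; move=> g gs; exists U, s; split. Qed.

Lemma germ_pt_image U (s : F U) : germ_pt @` germ_image s = U.
Proof.
apply/seteqP; split => [_ [_ [x [Ux ->]] <-]//|x Ux].
by exists (germ_at s Ux) => //; exists x, Ux.
Qed.

Lemma germ_pt_continuous : continuous germ_pt.
Proof.
apply/continuousP => A oA; rewrite open_germsE => g gA; have [U [s [x [Ux e]]]] := germs_surj g.
have Ax : A x by move: gA; rewrite /preimage /= e.
pose V : opens B := opensI (Opens oA) U.
have VU : V `<=` U by move=> ? [].
exists V, (res VU s); split.
  by have Vx : oset V x by []; exists x, Vx; rewrite e (germ_at_res _ _ _ Ux).
by move=> _ [y [[Ay Uy] ->]].
Qed.

Lemma germ_pt_lh : local_homeomorphism germ_pt.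
Proof.
move=> e; have [U [s [x [Ux ->]]]] := germs_surj e.
exists (germ_image s); rewrite germ_pt_image; split.
- exact: open_germ_image.
- by exists x, Ux.
- exact: opens_open.
- exact/continuous_subspaceT/germ_pt_continuous.
pose g (y : B) : germs :=
  if pselect (oset U y) is left Uy then germ_at s Uy else germ_at s Ux.
have gE y (Uy : oset U y) : g y = germ_at s Uy.
  rewrite /g; case: pselect => // Uy'.
  by rewrite (Prop_irrelevance Uy' Uy).
exists g; last by move=> _ [y [Uy ->]]; rewrite gE.
rewrite continuous_open_subspace; last exact: opens_open.
move=> y /set_mem Uy A.
rewrite gE !nbhsE => -[O [oO Og] OA].
move: oO; rewrite open_germsE => oO.
have [W [t [[z [Wz ez]] tO]]] := oO _ Og.
have yz : y = z by exact: (congr1 (@projT1 _ _) ez).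
subst z; have /germ_atP[X [Xy [h [h' st]]]] := ez.
exists X; first by split => //; exact: opens_open.
move=> z Xz; apply/OA/tO; exists z, (h' _ Xz).
by rewrite (gE _ (h _ Xz)); apply/germ_atP; exists X; split => //; exists h, h'.
Qed.

Definition gamma : sheaf B := Sheaf germ_pt_lh.

End Germs.

Section SheafOperations.
Variable B : topologicalType.

Definition sh_prod (I : Type) (F : I -> sheaf B) : sheaf B :=
  gamma (psh_prod (fun i => sigma (F i))).
Definition sh_coprod (I : Type) (F : I -> sheaf B) : sheaf B :=
  gamma (psh_coprod (fun i => sigma (F i))).
Definition sh_hom (F G : sheaf B) : sheaf B :=
  gamma (psh_hom (sigma F) (sigma G)).
Definition sh_char0 : sheaf B := gamma (psh_char0 B).

End SheafOperations.

(** * First-order formulas and intuitionistic predicate calculus *)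

(* Individual variables are natural numbers, and so are the predicate variables
   of each arity; [Atom n P xs] is the n-ary predicate variable P applied to
   the variables xs. *)
Inductive formula : Type :=
| Atom (n : nat) (P : nat) (xs : n.-tuple nat)
| Bot
| And (a b : formula)
| Or (a b : formula)
| Imp (a b : formula)
| Ex (x : nat) (a : formula)
| All (x : nat) (a : formula).

HB.instance Definition _ := gen_eqMixin formula.

Fixpoint free (x : nat) (a : formula) : bool :=
  match a with
  | Atom _ _ xs => x \in tval xs
  | Bot => false
  | And a b | Or a b | Imp a b => free x a || free x b
  | Ex z a | All z a => (x != z) && free x a
  end.

(* [subst x y a] is a[y/x], the free occurrences of x being replaced by y. *)
Fixpoint subst (x y : nat) (a : formula) : formula :=
  match a with
  | Atom _ P xs =>
      Atom P (map_tuple (fun z => if z == x then y else z) xs)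
  | Bot => Bot
  | And a b => And (subst x y a) (subst x y b)
  | Or a b => Or (subst x y a) (subst x y b)
  | Imp a b => Imp (subst x y a) (subst x y b)
  | Ex z a => Ex z (if z == x then a else subst x y a)
  | All z a => All z (if z == x then a else subst x y a)
  end.

(* No free occurrence of x in a lies in the scope of a quantifier over y. *)
Fixpoint free_for (x y : nat) (a : formula) : bool :=
  match a with
  | Atom _ _ _ | Bot => true
  | And a b | Or a b | Imp a b => free_for x y a && free_for x y b
  | Ex z a | All z a =>
      ~~ free x (All z a) || (z != y) && free_for x y a
  end.

Inductive derivable (hyps : seq formula) : formula -> Prop :=
| d_hyp a : a \in hyps -> derivable hyps a
| d_mp a b : derivable hyps (Imp a b) -> derivable hyps a -> derivable hyps b
| d_gen x a : derivable hyps a -> derivable hyps (All x a)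
| d_K a b : derivable hyps (Imp a (Imp b a))
| d_S a b c :
    derivable hyps (Imp (Imp a (Imp b c)) (Imp (Imp a b) (Imp a c)))
| d_andl a b : derivable hyps (Imp (And a b) a)
| d_andr a b : derivable hyps (Imp (And a b) b)
| d_and a b : derivable hyps (Imp a (Imp b (And a b)))
| d_orl a b : derivable hyps (Imp a (Or a b))
| d_orr a b : derivable hyps (Imp b (Or a b))
| d_or a b c :
    derivable hyps (Imp (Imp a c) (Imp (Imp b c) (Imp (Or a b) c)))
| d_bot a : derivable hyps (Imp Bot a)
| d_allE x y a : free_for x y a ->
    derivable hyps (Imp (All x a) (subst x y a))
| d_exI x y a : free_for x y a ->
    derivable hyps (Imp (subst x y a) (Ex x a))
| d_allI x a b : ~~ free x a ->
    derivable hyps (Imp (All x (Imp a b)) (Imp a (All x b)))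
| d_exE x a b : ~~ free x b ->
    derivable hyps (Imp (All x (Imp a b)) (Imp (Ex x a) b)).

(** * Structures *)

Definition presheaf_structure (B : topologicalType) (D : Type) : Type :=
  forall n : nat, nat -> n.-tuple D -> presheaf B.

Definition sheaf_structure (B : topologicalType) (D : Type) : Type :=
  forall n : nat, nat -> n.-tuple D -> sheaf B.

Definition upd (D : Type) (mu : nat -> D) (x : nat) (d : D) : nat -> D :=
  fun y => if y == x then d else mu y.

Definition pair_family (T : Type) (s t : T) (b : bool) : T := if b then s else t.

Fixpoint psh_eval (B : topologicalType) (D : Type) (S : presheaf_structure B D)
    (mu : nat -> D) (a : formula) : presheaf B :=
  match a with
  | Atom n P xs => S n P (map_tuple mu xs)
  | Bot => psh_char0 B
  | And a b => psh_prod (pair_family (psh_eval S mu a) (psh_eval S mu b))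
  | Or a b => psh_coprod (pair_family (psh_eval S mu a) (psh_eval S mu b))
  | Imp a b => psh_hom (psh_eval S mu a) (psh_eval S mu b)
  | Ex x a => psh_coprod (fun d : D => psh_eval S (upd mu x d) a)
  | All x a => psh_prod (fun d : D => psh_eval S (upd mu x d) a)
  end.

Fixpoint sh_eval (B : topologicalType) (D : Type) (S : sheaf_structure B D)
    (mu : nat -> D) (a : formula) : sheaf B :=
  match a with
  | Atom n P xs => S n P (map_tuple mu xs)
  | Bot => sh_char0 B
  | And a b => sh_prod (pair_family (sh_eval S mu a) (sh_eval S mu b))
  | Or a b => sh_coprod (pair_family (sh_eval S mu a) (sh_eval S mu b))
  | Imp a b => sh_hom (sh_eval S mu a) (sh_eval S mu b)
  | Ex x a => sh_coprod (fun d : D => sh_eval S (upd mu x d) a)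
  | All x a => sh_prod (fun d : D => sh_eval S (upd mu x d) a)
  end.

Definition psh_valid (B : topologicalType) (D : Type)
    (S : presheaf_structure B D) (a : formula) : Prop :=
  forall mu : nat -> D, inhabited (psh_eval S mu a (opensT B)).

Definition sh_valid (B : topologicalType) (D : Type)
    (S : sheaf_structure B D) (a : formula) : Prop :=
  forall mu : nat -> D, inhabited (shsection (sh_eval S mu a) (opensT B)).

(* [valid] is the validity predicate of a structure. *)
Definition is_model (valid : formula -> Prop) : Prop :=
  forall (hyps : seq formula) (a : formula), derivable hyps a ->
    (forall h, h \in hyps -> valid h) -> valid a.

(* Every presheaf of the structure has a section over the empty set.  Since
   Char of the empty set has one, Bot -> P can only be valid in this case. *)
Definition sections_over_empty (B : topologicalType) (D : Type)
    (S : presheaf_structure B D) : Prop :=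
  forall (n P : nat) (ds : n.-tuple D), inhabited (S n P ds (opens0 B)).

Lemma is_model_sections_over_empty (B : topologicalType) (D : Type)
    (S : presheaf_structure B D) :
  is_model (psh_valid S) -> inhabited D -> sections_over_empty S.
Proof.
move=> mS [d0] n P ds; pose xs : n.-tuple nat := [tuple val i | i < n].
pose mu x := nth d0 ds x.
have dsE : map_tuple mu xs = ds.
  apply: eq_from_tnth => i; rewrite tnth_map tnth_mktuple /mu.
  by rewrite -tnth_nth.
have [//|f] := mS [::] (Imp Bot (Atom P xs)) (d_bot _ _) _ mu.
have := f (opens0 B) (@subsetT _ _) (exist _ tt erefl) => /=.
by rewrite dsE => s; exists.
Qed.

(* Main.v *)
(* Order presheaves by the existence of a morphism.  Up to this preorder,
   products are infima, coproducts are suprema and Hom is Heyting implication,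
   and a formula is valid when its value has a global section, so soundness only
   needs these order-theoretic properties and no coherence between morphisms.
   For sheaves one orders presheaves of sections.  Since products of sheaves and
   Hom into a sheaf, computed in presheaves, already have unique gluing, and
   since the sheaf of germs is a reflection onto presheaves with unique gluing,
   the sheaf operations satisfy the same properties. *)

Require Import Defs.
From mathcomp Require Import all_boot all_classical topology.

Set Implicit Arguments.
Unset Strict Implicit.
Unset Printing Implicit Defensive.

Local Open Scope classical_set_scope.

(** * Soundness in Heyting prealgebras *)

(* [hglobal] stands for the existence of a global section.  Minimality of
   [hbot] is not part of the structure: among presheaves [psh_char0] is below F
   only if F has a section over the empty set. *)
Record heyting_prealgebra := HeytingPrealgebra {
  hcar :> Type;
  hle : hcar -> hcar -> Prop;
  hprod : forall I : Type, (I -> hcar) -> hcar;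
  hcoprod : forall I : Type, (I -> hcar) -> hcar;
  hhom : hcar -> hcar -> hcar;
  hbot : hcar;
  hglobal : hcar -> Prop;
  hle_refl : forall X, hle X X;
  hle_trans : forall X Y Z, hle X Y -> hle Y Z -> hle X Z;
  hle_prod : forall I (F : I -> hcar) X,
    hle X (hprod F) <-> forall i, hle X (F i);
  hle_coprod : forall I (F : I -> hcar) X,
    hle (hcoprod F) X <-> forall i, hle (F i) X;
  hle_hom : forall X Y Z,
    hle X (hhom Y Z) <-> hle (hprod (pair_family X Y)) Z;
  hglobal_le : forall X Y, hle X Y -> hglobal X -> hglobal Y;
  hglobal_hom : forall X Y, hglobal (hhom X Y) <-> hle X Y;
  hglobal_prod : forall I (F : I -> hcar),
    (forall i, hglobal (F i)) -> hglobal (hprod F) }.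

(** * Updates of valuations and substitution *)

Section Valuations.
Variable D : Type.
Implicit Types (mu : nat -> D) (x y : nat) (d e : D).

Lemma upd_same mu x d e : upd (upd mu x d) x e = upd mu x e.
Proof. by apply/funext => y; rewrite /upd; case: eqP. Qed.

Lemma upd_comm mu x y d e :
  x != y -> upd (upd mu x d) y e = upd (upd mu y e) x d.
Proof.
by move=> xy; apply/funext => z; rewrite /upd; case: (eqVneq z x) => // ->;
  rewrite (negbTE xy).
Qed.

End Valuations.

Lemma subst_nfree x y a : ~~ free x a -> subst x y a = a.
Proof.
elim: a => [n P xs|//|a IHa b IHb|a IHa b IHb|a IHa b IHb|z a IHa|z a IHa] /=.
- move=> xxs; congr Atom; apply: eq_from_tnth => i; rewrite tnth_map.
  by case: eqP => // xsx; move: xxs; rewrite -xsx mem_tnth.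
- by rewrite negb_or => /andP[/IHa -> /IHb ->].
- by rewrite negb_or => /andP[/IHa -> /IHb ->].
- by rewrite negb_or => /andP[/IHa -> /IHb ->].
- by rewrite (eq_sym x); case: eqP => //= _ /IHa ->.
- by rewrite (eq_sym x); case: eqP => //= _ /IHa ->.
Qed.

Section Soundness.
Variables (H : heyting_prealgebra) (D : Type).
Variable S : forall n : nat, nat -> n.-tuple D -> H.
Implicit Types (X Y Z : H) (mu : nat -> D) (a b : formula).

(** Over [psh_heyting] and [sh_heyting] this gives back [psh_eval] and [sh_eval]. *)
Fixpoint heval (mu : nat -> D) (a : formula) : H :=
  match a with
  | Atom _ P xs => S P (map_tuple mu xs)
  | Bot => hbot H
  | And a b => hprod (pair_family (heval mu a) (heval mu b))
  | Or a b => hcoprod (pair_family (heval mu a) (heval mu b))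
  | Imp a b => hhom (heval mu a) (heval mu b)
  | Ex x a => hcoprod (fun d : D => heval (upd mu x d) a)
  | All x a => hprod (fun d : D => heval (upd mu x d) a)
  end.

(** At a quantifier over [x] the inner update overrides the outer one; at any other quantifier the
    two updates commute. Equality, rather than equivalence in the preorder, permits rewriting. *)
Lemma heval_upd_nfree x a mu d :
  ~~ free x a -> heval (upd mu x d) a = heval mu a.
Proof.
elim: a mu => [n P xs|//|a IHa b IHb|a IHa b IHb|a IHa b IHb|z a IHa|z a IHa]
  mu /=.
- move=> xxs; congr S; apply: eq_from_tnth => i; rewrite !tnth_map /upd.
  by case: eqP => // xsx; move: xxs; rewrite -xsx mem_tnth.
- by rewrite negb_or => /andP[/IHa -> /IHb ->].
- by rewrite negb_or => /andP[/IHa -> /IHb ->].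
- by rewrite negb_or => /andP[/IHa -> /IHb ->].
- move=> xa; congr hcoprod; apply/funext => e.
  have [<-|xz] := eqVneq x z; first by rewrite upd_same.
  by rewrite upd_comm// IHa//; rewrite xz in xa.
- move=> xa; congr hprod; apply/funext => e.
  have [<-|xz] := eqVneq x z; first by rewrite upd_same.
  by rewrite upd_comm// IHa//; rewrite xz in xa.
Qed.

Lemma heval_subst x y a mu : free_for x y a ->
  heval mu (subst x y a) = heval (upd mu x (mu y)) a.
Proof.
(* This treats both quantifiers when the bound variable is not [x]. Either [x] is not free in the
   body, and both the substitution and the update at [x] have no effect, or [z] differs from [y],
   and the update at [z] keeps the value of [y]. *)
have bound z b e nu : z != x ->
    (forall nu', free_for x y b ->
      heval nu' (subst x y b) = heval (upd nu' x (nu' y)) b) ->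
    ~~ free x (All z b) || (z != y) && free_for x y b ->
    heval (upd nu z e) (subst x y b) = heval (upd (upd nu x (nu y)) z e) b.
  move=> zx IHb /= /orP[|/andP[zy fb]].
    rewrite eq_sym zx /= => xb; rewrite (subst_nfree _ xb).
    by rewrite -(upd_comm _ _ _ zx) (heval_upd_nfree _ _ xb).
  rewrite IHb// (upd_comm _ _ _ zx); congr (heval (upd _ _ _) _).
  by rewrite /upd eq_sym (negbTE zy).
elim: a mu => [n P xs|//|a IHa b IHb|a IHa b IHb|a IHa b IHb|z a IHa|z a IHa]
  mu.
- by move=> _ /=; congr S; apply: eq_from_tnth => i;
    rewrite !tnth_map /upd; case: eqP.
- by move=> /= /andP[/IHa -> /IHb ->].
- by move=> /= /andP[/IHa -> /IHb ->].
- by move=> /= /andP[/IHa -> /IHb ->].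
- move=> za; rewrite [subst _ _ _]/=; congr hcoprod; apply/funext => e.
  by have [->|zx] := eqVneq z x; [rewrite upd_same | exact: bound].
- move=> za; rewrite [subst _ _ _]/=; congr hprod; apply/funext => e.
  by have [->|zx] := eqVneq z x; [rewrite upd_same | exact: bound].
Qed.

(** * Derived inequalities and soundness *)

Lemma hprod_le I (F : I -> H) i : hle (hprod F) (F i).
Proof. by have /hle_prod := hle_refl (hprod F); exact. Qed.

Lemma le_hcoprod I (F : I -> H) i : hle (F i) (hcoprod F).
Proof. by have /hle_coprod := hle_refl (hcoprod F); exact. Qed.

Lemma hand_lel X Y : hle (hprod (pair_family X Y)) X.
Proof. exact: (hprod_le (pair_family X Y) true). Qed.

Lemma hand_ler X Y : hle (hprod (pair_family X Y)) Y.
Proof. exact: (hprod_le (pair_family X Y) false). Qed.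

Lemma hand_wkl X Y Z : hle X Z -> hle (hprod (pair_family X Y)) Z.
Proof. exact/hle_trans/hand_lel. Qed.

Lemma hand_wkr X Y Z : hle Y Z -> hle (hprod (pair_family X Y)) Z.
Proof. exact/hle_trans/hand_ler. Qed.

Lemma hle_and X Y Z : hle X Y -> hle X Z -> hle X (hprod (pair_family Y Z)).
Proof. by move=> XY XZ; apply/hle_prod; case. Qed.

Lemma hle_mp X Y Z : hle X (hhom Y Z) -> hle X Y -> hle X Z.
Proof.
move=> /hle_hom XYZ XY; apply: hle_trans XYZ.
by apply: hle_and => //; exact: hle_refl.
Qed.

Lemma hglobal_mp X Y : hglobal (hhom X Y) -> hglobal X -> hglobal Y.
Proof. by move=> /hglobal_hom; exact: hglobal_le. Qed.

(** Induction on the derivation, with the valuation quantified inside: generalization is then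
    [hglobal_prod], also on variables free in hypotheses. Each axiom becomes an inequality by
    [hglobal_hom]. Minimality of [hbot] is asked only against values of formulas. *)
Lemma soundness : (forall mu a, hle (hbot H) (heval mu a)) ->
  is_model (fun a => forall mu, hglobal (heval mu a)).
Proof.
move=> bot_le hyps a0 da0 hypsP.
have le1 := @hle_refl H.
elim: da0 => {a0} /=.
- by move=> a /hypsP.
- by move=> a b _ IHab _ IHa mu; exact: hglobal_mp (IHab mu) (IHa mu).
- by move=> x a _ IHa mu; apply: hglobal_prod.
- by move=> a b mu; apply/hglobal_hom/hle_hom/hand_lel.
- move=> a b c mu; apply/hglobal_hom/hle_hom/hle_hom.
  by apply: (hle_mp (Y := heval mu b)); apply: (hle_mp (Y := heval mu a));
    auto using hand_wkl, hand_wkr.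
- by move=> a b mu; apply/hglobal_hom/hand_lel.
- by move=> a b mu; apply/hglobal_hom/hand_ler.
- by move=> a b mu; apply/hglobal_hom/hle_hom.
- move=> a b mu; apply/hglobal_hom.
  exact: (le_hcoprod (pair_family _ _) true).
- move=> a b mu; apply/hglobal_hom.
  exact: (le_hcoprod (pair_family _ _) false).
- move=> a b c mu; apply/hglobal_hom/hle_hom/hle_hom.
  (* [hle_coprod] needs the disjunction alone on the left, so the context [K] is moved to the right
     as the premise of a Hom. The axiom [d_exE] below is treated in the same way. *)
  set K := (X in pair_family X _).
  apply: (hle_mp (Y := K)); last exact: hand_lel.
  apply: hand_wkr; apply/hle_coprod => -[] /=; apply/hle_hom.
    by apply: (hle_mp (Y := heval mu a)); rewrite /K;
      auto using hand_wkl, hand_wkr.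
  by apply: (hle_mp (Y := heval mu b)); rewrite /K;
    auto using hand_wkl, hand_wkr.
- by move=> a mu; apply/hglobal_hom.
- move=> x y a xya mu; apply/hglobal_hom; rewrite heval_subst//.
  exact: (hprod_le (fun d => heval (upd mu x d) a)).
- move=> x y a xya mu; apply/hglobal_hom; rewrite heval_subst//.
  exact: (le_hcoprod (fun d => heval (upd mu x d) a)).
- move=> x a b xa mu; apply/hglobal_hom/hle_hom/hle_prod => d.
  apply: (hle_mp (Y := heval mu a)); last exact: hand_ler.
  (* As [x] is not free in [a], the premise may be evaluated at the updated valuation, where it
     matches the component at [d]. *)
  apply: hand_wkl; rewrite -(heval_upd_nfree mu d xa).
  exact: (hprod_le (fun d => hhom (heval (upd mu x d) a) _)).
- move=> x a b xb mu; apply/hglobal_hom/hle_hom.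
  set P := (X in pair_family X _).
  apply: (hle_mp (Y := P)); last exact: hand_lel.
  apply: hand_wkr; apply/hle_coprod => d; apply/hle_hom.
  apply: (hle_mp (Y := heval (upd mu x d) a)); last exact: hand_lel.
  apply: hand_wkr; rewrite -(heval_upd_nfree mu d xb).
  exact: (hprod_le (fun d => hhom _ (heval (upd mu x d) b))).
Qed.
End Soundness.

(** * Presheaves *)

Section Presheaves.
Variable B : topologicalType.
Implicit Types (F G H : presheaf B) (U V W : opens B).

(** By definition this says that [psh_hom F G] has a global section, so [hglobal_hom] is a tautology
    for presheaves. *)
Definition psh_le F G : Prop := inhabited (mor F G (opensT B)).

Lemma psh_le_intro F G (f : forall V, F V -> G V) :
  (forall V W (l : W `<=` V) s, res l (f V s) = f W (res l s)) -> psh_le F G.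
Proof.
by move=> fn; constructor; refine (@Mor B F G (opensT B) (fun V _ => f V) _).
Qed.

Lemma psh_le_elim F G : psh_le F G -> exists f : forall V, F V -> G V,
  forall V W (l : W `<=` V) s, res l (f V s) = f W (res l s).
Proof.
by case=> f; exists (fun V => f V (@subsetT _ V)) => V W l s; exact: mor_nat.
Qed.

Lemma psh_le_refl F : psh_le F F.
Proof. exact: (@psh_le_intro F F (fun V s => s)). Qed.

Lemma psh_le_trans F G H : psh_le F G -> psh_le G H -> psh_le F H.
Proof.
move=> /psh_le_elim[f fn] /psh_le_elim[g gn].
by apply: (@psh_le_intro F H (fun V s => g V (f V s))) => V W l s;
  rewrite gn fn.
Qed.

(** The order records only that morphisms exist, so choice picks one for each index; the same holds
    for coproducts. *)
Lemma psh_le_prod I (F : I -> presheaf B) G :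
  psh_le G (psh_prod F) <-> forall i, psh_le G (F i).
Proof.
split=> [/psh_le_elim[f fn] i|].
  apply: (@psh_le_intro G (F i) (fun V s => f V s i)) => V W l s.
  by rewrite -fn.
move=> GF; have f i := cid (psh_le_elim (GF i)).
apply: (@psh_le_intro G (psh_prod F) (fun V s i => sval (f i) V s)).
move=> V W l s; apply: functional_extensionality_dep => i /=.
exact: (svalP (f i)).
Qed.

Lemma psh_le_coprod I (F : I -> presheaf B) G :
  psh_le (psh_coprod F) G <-> forall i, psh_le (F i) G.
Proof.
split=> [/psh_le_elim[f fn] i|].
  apply: (@psh_le_intro (F i) G (fun V s => f V (existT _ i s))) => V W l s.
  by rewrite fn.
move=> FG; have f i := cid (psh_le_elim (FG i)).
apply: (@psh_le_intro (psh_coprod F) G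
  (fun V s => sval (f (projT1 s)) V (projT2 s))).
by move=> V W l [i s] /=; exact: (svalP (f i)).
Qed.

Definition psh_pair F G V (s : F V) (t : G V) :
    psh_prod (pair_family F G) V :=
  fun b => match b return pair_family F G b V with true => s | false => t end.

Lemma res_psh_pair F G V W (l : W `<=` V) (s : F V) (t : G V) :
  res l (psh_pair s t) = psh_pair (res l s) (res l t).
Proof. by apply: functional_extensionality_dep => -[]. Qed.

(** Currying. One direction evaluates a section of Hom over [V] at [V] itself; the other sends [s]
    over [V] to the morphism that pairs restrictions of [s] with sections of [G]. *)
Lemma psh_le_hom F G H :
  psh_le F (psh_hom G H) <-> psh_le (psh_prod (pair_family F G)) H.
Proof.
split=> /psh_le_elim[f fn].
  apply: (@psh_le_intro (psh_prod (pair_family F G)) H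
    (fun V s => f V (s true) V (@subset_refl _ V) (s false))).
  move=> V W l s /=; rewrite -fn.
  by rewrite (mor_nat _ _ (subset_trans (@subset_refl _ W) l)).
have g V (s : F V) : {g : mor G H V |
    forall W (k : W `<=` V) t, g W k t = f W (psh_pair (res k s) t)}.
  unshelve eexists.
    refine (@Mor B G H V (fun W k t => f W (psh_pair (res k s) t)) _).
    by move=> W X h k l t; rewrite fn res_psh_pair (res_comp h l k).
  by [].
apply: (@psh_le_intro F (psh_hom G H) (fun V s => sval (g V s))) => V W l s.
apply: mor_eq => X h t /=; rewrite !(svalP (g _ _)).
by rewrite (res_comp l h (subset_trans h l)).
Qed.

Definition psh_global F : Prop := inhabited (F (opensT B)).

Lemma psh_global_le F G : psh_le F G -> psh_global F -> psh_global G.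
Proof. by move=> /psh_le_elim[f _] [s]; constructor; exact: f. Qed.

Lemma psh_global_prod I (F : I -> presheaf B) :
  (forall i, psh_global (F i)) -> psh_global (psh_prod F).
Proof.
move=> Fg; have Fg' i : exists s : F i (opensT B), True.
  by case: (Fg i) => s; exists s.
by constructor => i; exact: sval (cid (Fg' i)).
Qed.

Definition psh_heyting : heyting_prealgebra :=
  HeytingPrealgebra (psh_char0 B) psh_le_refl psh_le_trans psh_le_prod
    psh_le_coprod psh_le_hom psh_global_le
    (fun F G => iff_refl (psh_global (psh_hom F G))) psh_global_prod.

(** [psh_char0] has sections only over empty sets, so restrictions of one section of [F] over the
    empty set serve as all values. *)
Lemma psh_char0_le F : inhabited (F (opens0 B)) -> psh_le (psh_char0 B) F.
Proof.
move=> [s0]; have sub V (s : psh_char0 B V) : V `<=` opens0 B.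
  by case: s => _ e; rewrite e.
apply: (@psh_le_intro (psh_char0 B) F (fun V s => res (sub V s) s0)).
by move=> V W l s; rewrite (res_comp _ _ (sub W (res l s))).
Qed.

(** This places [psh_char0] below every value. An implication receives the constant morphism at a
    section of its conclusion, a disjunction uses its left side, and an existential takes its
    witness from the nonempty domain. *)
Lemma psh_eval_inhabited0 D (S : presheaf_structure B D) mu a :
  inhabited D -> sections_over_empty S ->
  inhabited (psh_eval S mu a (opens0 B)).
Proof.
move=> [d0] S0.
elim: a mu => [n P xs||a IHa b IHb|a IHa b IHb|a IHa b IHb|z a IHa|z a IHa]
  mu /=.
- exact: (S0 n P).
- by constructor; exists tt.
- by case: (IHa mu) (IHb mu) => s [t]; constructor; exact: psh_pair.
- by case: (IHa mu) => s; constructor; exists true.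
- case: (IHb mu) => t; constructor.
  refine (@Mor B _ _ (opens0 B) (fun V h _ => res h t) _).
  by move=> V W h k l s; exact: res_comp.
- by case: (IHa (upd mu z d0)) => s; constructor; exists d0.
- have IH d : exists s : psh_eval S (upd mu z d) a (opens0 B), True.
    by case: (IHa (upd mu z d)) => s; exists s.
  by constructor => d; exact: sval (cid (IH d)).
Qed.

End Presheaves.

(** * Presheaf structures as models *)

Lemma psh_evalE (B : topologicalType) D (S : presheaf_structure B D) mu a :
  psh_eval S mu a = @heval (psh_heyting B) D S mu a.
Proof.
elim: a mu => //= [a IHa b IHb|a IHa b IHb|a IHa b IHb|z a IHa|z a IHa] mu;
  rewrite ?IHa ?IHb//.
- by congr psh_coprod; apply/funext => d; exact: IHa.
- by congr psh_prod; apply/funext => d; exact: IHa.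
Qed.

Lemma psh_validE (B : topologicalType) D (S : presheaf_structure B D) :
  psh_valid S = fun a => forall mu, hglobal (@heval (psh_heyting B) D S mu a).
Proof.
apply/funext => a; apply/propext; split=> va mu; have := va mu.
  by rewrite psh_evalE.
by rewrite -psh_evalE.
Qed.

Lemma psh_is_model (B : topologicalType) D (S : presheaf_structure B D) :
  inhabited D -> sections_over_empty S -> is_model (psh_valid S).
Proof.
move=> D0 S0; rewrite psh_validE; apply: soundness => mu a.
by rewrite -psh_evalE; exact/psh_char0_le/psh_eval_inhabited0.
Qed.

(** * Presheaves with unique gluing *)

Section Gluing.
Variable B : topologicalType.
Implicit Types (P Q : presheaf B) (F G : sheaf B) (U V W : opens B).

Definition separated Q : Prop := forall U (s t : Q U),
  (forall x, oset U x ->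
     exists W (h : W `<=` U), oset W x /\ res h s = res h t) -> s = t.

(* The family to be glued is given as a relation rather than as an indexed
   family, so that no index type has to be chosen. *)
Definition has_gluing Q : Prop :=
  forall U (R : forall V, V `<=` U -> Q V -> Prop),
  (forall x, oset U x -> exists V (h : V `<=` U) s, oset V x /\ R V h s) ->
  (forall V V' (h : V `<=` U) (h' : V' `<=` U) s s', R V h s -> R V' h' s' ->
     forall W (k : W `<=` V) (k' : W `<=` V'), res k s = res k' s') ->
  exists t : Q U, forall V (h : V `<=` U) s, R V h s -> res h t = s.

Definition is_sheaf Q : Prop := separated Q /\ has_gluing Q.

Lemma res_irr Q U V (h h' : V `<=` U) (s : Q U) : res h s = res h' s.
Proof. by rewrite (Prop_irrelevance h h'). Qed.

Lemma mor_irr P Q U (f : mor P Q U) V (h h' : V `<=` U) (s : P V) :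
  f V h s = f V h' s.
Proof. by rewrite (Prop_irrelevance h h'). Qed.

Lemma is_sheaf_prod I (Q : I -> presheaf B) :
  (forall i, is_sheaf (Q i)) -> is_sheaf (psh_prod Q).
Proof.
move=> shQ; split.
  move=> U s t st; apply: functional_extensionality_dep => i.
  apply: (shQ i).1 => x /st[W [h [Wx e]]]; exists W, h; split=> //.
  exact: (congr1 (fun u : psh_prod Q W => u i) e).
move=> U R cov comp.
have t i : {t : Q i U | forall V (h : V `<=` U) s, R V h s -> res h t = s i}.
  apply: cid.
  have [] := (shQ i).2 U (fun V h u => exists2 s, R V h s & u = s i).
  - move=> x /cov[V [h [s [Vx Rs]]]]; exists V, h, (s i); split=> //.
    by exists s.
  - move=> V V' h h' _ _ [s Rs ->] [s' Rs' ->] W k k'.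
    have e := comp _ _ _ _ _ _ Rs Rs' _ k k'.
    exact: (congr1 (fun u : psh_prod Q W => u i) e).
  - by move=> t tP; exists t => V h s Rs; apply: tP; exists s.
exists (fun i => sval (t i)) => V h s Rs.
by apply: functional_extensionality_dep => i; exact: (svalP (t i)).
Qed.

(** The glued morphism is built value by value: its value at [s] glues in [Q] the values of the
    given local morphisms at restrictions of [s]. Separation of [Q] then yields naturality. *)
Lemma is_sheaf_hom P Q : is_sheaf Q -> is_sheaf (psh_hom P Q).
Proof.
move=> [sepQ glueQ]; split.
  move=> U f g fg; apply: mor_eq => V h s; apply: sepQ => x Vx.
  have [W [k [Wx e]]] := fg x (h _ Vx).
  pose X := opensI V W; have XV : X `<=` V by move=> ? [].
  have XW : X `<=` W by move=> ? [].
  exists X, XV; split=> //; rewrite !(mor_nat _ _ (subset_trans XW k)).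
  exact: (congr1 (fun u : psh_hom P Q W => u X XW (res XV s)) e).
move=> U R cov comp.
have ex V (h : V `<=` U) (s : P V) : exists t : Q V,
    forall X (f : mor P Q X) (k : X `<=` U), R X k f ->
    forall W (l : W `<=` V) (m : W `<=` X), res l t = f W m (res l s).
  have [] := glueQ V (fun W l q => exists X (f : mor P Q X) (k : X `<=` U)
    (m : W `<=` X), R X k f /\ q = f W m (res l s)).
  - move=> x Vx; have [X [k [f [Xx Rf]]]] := cov x (h _ Vx).
    have XV : opensI V X `<=` V by move=> ? [].
    have XX : opensI V X `<=` X by move=> ? [].
    exists (opensI V X), XV, (f _ XX (res XV s)); split=> //.
    by exists X, f, k, XX.
  - move=> W W' l l' _ _ [X [f [k [m [Rf ->]]]]] [X' [f' [k' [m' [Rf' ->]]]]].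
    (* Both local values restrict to the value over [Y] at the restriction of [s], where the two
       morphisms agree by compatibility. *)
    move=> Y j j'; have e := comp _ _ _ _ _ _ Rf Rf' Y
      (subset_trans j m) (subset_trans j' m').
    rewrite (mor_nat _ _ (subset_trans j m)).
    rewrite (mor_nat _ _ (subset_trans j' m')).
    rewrite (res_comp l j (subset_trans j l)).
    rewrite (res_comp l' j' (subset_trans j l)).
    have := congr1 (fun u : psh_hom P Q Y =>
      u Y (@subset_refl _ Y) (res (subset_trans j l) s)) e.
    move=> /=.
    by rewrite (mor_irr _ _ (subset_trans j m)) => ->; exact: mor_irr.
  - move=> t tP; exists t => X f k Rf W l m; apply: tP.
    by exists X, f, k, m.
pose g V (h : V `<=` U) s := sval (cid (ex V h s)).
have gP V (h : V `<=` U) s X (f : mor P Q X) (k : X `<=` U) : R X k f ->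
    forall W (l : W `<=` V) (m : W `<=` X), res l (g V h s) = f W m (res l s).
  exact: (svalP (cid (ex V h s))).
have gn V W (h : V `<=` U) (k : W `<=` U) (l : W `<=` V) (s : P V) :
    res l (g V h s) = g W k (res l s).
  apply: sepQ => x Wx; have [X [m [f [Xx Rf]]]] := cov x (k _ Wx).
  have YW : opensI W X `<=` W by move=> ? [].
  have YX : opensI W X `<=` X by move=> ? [].
  exists (opensI W X), YW; split=> //.
  rewrite (gP _ _ _ _ _ _ Rf _ _ YX) (res_comp _ _ (subset_trans YW l)).
  by rewrite (res_comp _ _ (subset_trans YW l)) (gP _ _ _ _ _ _ Rf _ _ YX).
exists (Mor gn) => V h f Rf; apply: mor_eq => W k s /=.
have := gP W (subset_trans k h) s V f h Rf W (@subset_refl _ W) k.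
by rewrite !res_id.
Qed.

(** * Sections and germs *)

(** Open sets of the subspace [U] are traces of open sets of [B]; in this form continuity is easy to
    compare between different open sets. *)
Lemma continuous_setP U (E : topologicalType) (f : U -> E) :
  continuous f <-> forall (x : U) (O : set E), nbhs (f x) O ->
    exists A : set B, [/\ open A, A (val x) &
      forall y : U, A (val y) -> O (f y)].
Proof.
split=> [cf x O /cf|cf x O /cf [A [oA Ax AO]]].
  rewrite /= nbhsE => -[O' [[A oA AO'] O'x] O'O].
  exists A; split=> //; first by rewrite -AO' in O'x.
  by move=> y Ay; apply: O'O; rewrite -AO'.
rewrite /= nbhsE; exists (val @^-1` A); last by move=> y /AO.
by split=> //; exists A.
Qed.

(** Sections are functions, so they are glued pointwise: compatibility makes the value at a point
    independent of the chosen member. Continuity is local, and the section identity is checked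
    pointwise. *)
Lemma is_sheaf_sigma F : is_sheaf (sigma F).
Proof.
have sval_eq U (s : shsection F U) (x y : U) : val x = val y -> s x = s y.
  by move=> /val_inj ->.
split.
  move=> U s t st; apply: shsection_eq => x.
  have [W [h [Wx e]]] := st (val x) (set_valP x).
  have := congr1 (fun u : shsection F W => u (SigSub (mem_set Wx))) e.
  rewrite /= (sval_eq _ s _ x)// (sval_eq _ t _ x)//.
move=> U R cov comp.
have ex (x : U) : exists e : Defs.total F,
    forall V (h : V `<=` U) (s : shsection F V) (y : V),
    R V h s -> val y = val x -> s y = e.
  have [V [h [s [Vx Rs]]]] := cov (val x) (set_valP x).
  exists (s (SigSub (mem_set Vx))) => V' h' s' y Rs' yx.
  have V'x : oset V' (val x) by rewrite -yx; exact: set_valP.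
  pose W := opensI V V'; have Wx : oset W (val x) by [].
  have WV : W `<=` V by move=> ? [].
  have WV' : W `<=` V' by move=> ? [].
  have e := comp _ _ _ _ _ _ Rs Rs' W WV WV'.
  have := congr1 (fun u : shsection F W => u (SigSub (mem_set Wx))) e.
  rewrite /= (sval_eq _ s _ (SigSub (mem_set Vx)))// => ->.
  exact: sval_eq.
pose t x := sval (cid (ex x)).
have tP x V (h : V `<=` U) (s : shsection F V) (y : V) :
    R V h s -> val y = val x -> s y = t x.
  exact: (svalP (cid (ex x))).
have tc : continuous t.
  apply/continuous_setP => x O.
  have [V [h [s [Vx Rs]]]] := cov (val x) (set_valP x).
  rewrite -(tP x _ _ _ (SigSub (mem_set Vx)) Rs erefl).
  have /continuous_setP sc := @sfun_continuous _ _ _ s.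
  (* Cutting down to [V] keeps the points where [t] is known to coincide with [s]. *)
  move=> /sc[A [oA Ax AO]]; exists (A `&` V); split=> //.
    by apply: openI => //; exact: opens_open.
  move=> y [Ay Vy]; rewrite -(tP y _ _ _ (SigSub (mem_set Vy)) Rs erefl).
  exact: AO.
have tK x : Defs.proj (t x) = val x.
  have [V [h [s [Vx Rs]]]] := cov (val x) (set_valP x).
  by rewrite -(tP x _ _ _ (SigSub (mem_set Vx)) Rs erefl) sfunK.
exists (ShSection tc tK) => V h s Rs; apply: shsection_eq => x /=.
by symmetry; exact: tP Rs _.
Qed.

(** If a basic open set [germ_image t] contains the germ of [s] at [x], then [s] and [t] agree near
    [x], so it contains the germs of [s] at all nearby points. *)
Lemma germ_section_continuous P V (s : P V) :
  continuous (fun x : V => germ_at s (set_valP x)).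
Proof.
apply/continuous_setP => x O.
rewrite nbhsE => -[O' [oO' O'x] O'O]; move: oO'; rewrite open_germsE => oO'.
have [W [t [[z [Wz ez]] tO']]] := oO' _ O'x.
have xz : val x = z by exact: (congr1 (@projT1 _ _) ez).
subst z; have /germ_atP[X [Xx [h [h' st]]]] := ez.
exists X; split=> //; first exact: opens_open.
move=> y Xy; apply/O'O/tO'; exists (val y), (h' _ Xy).
by apply/germ_atP; exists X; split=> //; exists h, h'.
Qed.

Definition germ_section P V (s : P V) : sigma (gamma P) V :=
  ShSection (F := gamma P) (@germ_section_continuous P V s) (fun x => erefl).

Lemma res_germ_section P V W (l : W `<=` V) (s : P V) :
  res l (germ_section s) = germ_section (res l s).
Proof.
by apply: shsection_eq => x /=; rewrite -(germ_at_res l s (set_valP x)).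
Qed.

(** * The sheaf of germs as a reflection *)

Lemma le_gamma P : psh_le P (sigma (gamma P)).
Proof.
by apply: (@psh_le_intro _ _ _ (@germ_section P)) => V W l s;
  exact: res_germ_section.
Qed.

Lemma germ_section_loc_inj P W (s t : P W) : germ_section s = germ_section t ->
  forall x, oset W x ->
    exists (X : opens B) (h : X `<=` W), oset X x /\ res h s = res h t.
Proof.
move=> st x Wx.
have := congr1 (fun u : shsection (gamma P) W => u (SigSub (mem_set Wx))) st.
move=> /germ_atP[X [Xx [h [h' e]]]].
by exists X, h; split=> //; rewrite e; exact: res_irr.
Qed.

(** Represent the germ [t x] by some [s]. As [germ_image s] is open, [t] stays in it near [x], and
    the only germ of [s] lying over a point is its germ at that point. *)
Lemma gamma_local P U (t : sigma (gamma P) U) x : oset U x ->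
  exists V (h : V `<=` U) (s : P V), oset V x /\ res h t = germ_section s.
Proof.
move=> Ux; pose x' : U := SigSub (mem_set Ux).
have [W [s [y [Wy e]]]] := germs_surj ((t : shsection _ _) x').
have /continuous_setP tc := @sfun_continuous _ _ _ t.
have [|A [oA Ax AO]] := tc x' (germ_image s).
  apply: open_nbhs_nbhs; split; first exact: open_germ_image.
  by exists y, Wy.
pose V := opensI (Opens oA) (opensI U W).
have VU : V `<=` U by move=> ? [? []].
have VW : V `<=` W by move=> ? [? []].
have yx : y = x.
  by rewrite -[y]/(germ_pt (germ_at s Wy)) -e; exact: (sfunK t x').
subst y; exists V, VU, (res VW s); split=> //.
apply: shsection_eq => z /=; pose z' := set_incl VU z.
have Vz := set_valP z.
have [|w [Ww ew]] := AO z'; first by case: Vz.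
have wz : w = val z.
  by rewrite -[w]/(germ_pt (germ_at s Ww)) -ew; exact: (sfunK t z').
by subst w; rewrite -/z' ew; symmetry; exact: germ_at_res.
Qed.

(* A section of the sheaf of germs of P is locally a section of P; its local
   images glue in Q. *)
Lemma gamma_le P Q : is_sheaf Q -> psh_le P Q -> psh_le (sigma (gamma P)) Q.
Proof.
move=> [sepQ glueQ] /psh_le_elim[f fn].
have ex U (t : sigma (gamma P) U) : exists q : Q U,
    forall V (h : V `<=` U) s, res h t = germ_section s -> res h q = f V s.
  have [] := glueQ U
    (fun V h q => exists2 s, res h t = germ_section s & q = f V s).
  - move=> x /(gamma_local t)[V [h [s [Vx ts]]]].
    by exists V, h, (f V s); split=> //; exists s.
  - move=> V V' h h' _ _ [s ts ->] [s' ts' ->] W k k'; rewrite !fn.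
    (* Two representatives of [t] have equal germs, hence agree only locally in [P]; separation of
       [Q] makes their images equal. *)
    apply: sepQ => x Wx.
    have ss' : germ_section (res k s) = germ_section (res k' s').
      rewrite -!res_germ_section -ts -ts' (res_comp _ _ (subset_trans k h)).
      by rewrite (res_comp _ _ (subset_trans k h)).
    have [X [l [Xx e]]] := germ_section_loc_inj ss' Wx.
    by exists X, l; split=> //; rewrite !fn e.
  - by move=> q qP; exists q => V h s ts; apply: qP; exists s.
apply: (@psh_le_intro _ _ _ (fun U t => sval (cid (ex U t)))) => U W l t.
case: cid => q qP /=; case: cid => q' q'P /=.
apply: sepQ => x Wx.
have [V [h [s [Vx ts]]]] := gamma_local (res l t) Wx.
exists V, h; split=> //; rewrite (q'P _ _ _ ts).
rewrite (res_comp _ _ (subset_trans h l)); apply: qP.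
by rewrite -(res_comp l h).
Qed.

(** For a presheaf with unique gluing, [le_gamma] has a converse by [gamma_le], so [gamma] changes
    nothing up to the preorder. *)
Lemma psh_le_gamma P Q : is_sheaf Q ->
  psh_le P (sigma (gamma Q)) <-> psh_le P Q.
Proof.
move=> shQ; split=> PQ; last exact: psh_le_trans PQ (le_gamma Q).
by apply: psh_le_trans PQ _; apply: gamma_le => //; exact: psh_le_refl.
Qed.

Lemma gamma_psh_le P F : psh_le (sigma (gamma P)) (sigma F) <-> psh_le P (sigma F).
Proof.
split; last exact/gamma_le/is_sheaf_sigma.
exact/psh_le_trans/le_gamma.
Qed.

Lemma psh_global_gamma Q : is_sheaf Q ->
  psh_global (sigma (gamma Q)) <-> psh_global Q.
Proof.
move=> shQ; split; last exact/psh_global_le/le_gamma.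
by apply/psh_global_le/psh_le_gamma => //; exact: psh_le_refl.
Qed.

(** The empty family covers the empty set and glues to a section. This makes [sh_char0] least. *)
Lemma sigma_inhabited0 F : inhabited (sigma F (opens0 B)).
Proof.
have [//|//|s _] := (is_sheaf_sigma F).2 (opens0 B) (fun _ _ _ => False).
by constructor.
Qed.

(** * The Heyting prealgebra of sheaves *)

Definition sh_le F G : Prop := psh_le (sigma F) (sigma G).

Lemma sh_le_prod I (F : I -> sheaf B) G :
  sh_le G (sh_prod F) <-> forall i, sh_le G (F i).
Proof.
apply: iff_trans (psh_le_prod _ _); apply: psh_le_gamma.
by apply: is_sheaf_prod => i; exact: is_sheaf_sigma.
Qed.

Lemma sh_le_coprod I (F : I -> sheaf B) G :
  sh_le (sh_coprod F) G <-> forall i, sh_le (F i) G.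
Proof. by apply: iff_trans (psh_le_coprod _ _); exact: gamma_psh_le. Qed.

(** [gamma] can be removed from the product because the target is a sheaf, and from Hom because that
    presheaf already has unique gluing; what remains is [psh_le_hom]. *)
Lemma sh_le_hom F G H :
  sh_le F (sh_hom G H) <-> sh_le (sh_prod (pair_family F G)) H.
Proof.
have e : (fun b => sigma (pair_family F G b)) = pair_family (sigma F) (sigma G).
  by apply/funext => -[].
apply: iff_trans (iff_sym (gamma_psh_le _ _)); rewrite e.
apply: iff_trans (psh_le_hom _ _ _); apply: psh_le_gamma.
exact/is_sheaf_hom/is_sheaf_sigma.
Qed.

Lemma sh_global_hom F G : psh_global (sigma (sh_hom F G)) <-> sh_le F G.
Proof. exact/psh_global_gamma/is_sheaf_hom/is_sheaf_sigma. Qed.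

Lemma sh_global_prod I (F : I -> sheaf B) :
  (forall i, psh_global (sigma (F i))) -> psh_global (sigma (sh_prod F)).
Proof.
by move=> Fg; apply: psh_global_le (le_gamma _) _; exact: psh_global_prod.
Qed.

Definition sh_heyting : heyting_prealgebra :=
  HeytingPrealgebra (sh_char0 B) (fun F => psh_le_refl (sigma F))
    (fun F G H => @psh_le_trans B (sigma F) (sigma G) (sigma H))
    sh_le_prod sh_le_coprod sh_le_hom
    (fun F G => @psh_global_le B (sigma F) (sigma G))
    sh_global_hom sh_global_prod.

Lemma sh_char0_le F : sh_le (sh_char0 B) F.
Proof. exact/gamma_psh_le/psh_char0_le/sigma_inhabited0. Qed.

End Gluing.

(** * Sheaf structures as models *)

Lemma sh_evalE (B : topologicalType) D (S : sheaf_structure B D) mu a :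
  sh_eval S mu a = @heval (sh_heyting B) D S mu a.
Proof.
elim: a mu => //= [a IHa b IHb|a IHa b IHb|a IHa b IHb|z a IHa|z a IHa] mu;
  rewrite ?IHa ?IHb//.
- by congr sh_coprod; apply/funext => d; exact: IHa.
- by congr sh_prod; apply/funext => d; exact: IHa.
Qed.

Lemma sh_validE (B : topologicalType) D (S : sheaf_structure B D) :
  sh_valid S = fun a => forall mu, hglobal (@heval (sh_heyting B) D S mu a).
Proof.
apply/funext => a; apply/propext; split=> va mu; have := va mu.
  by rewrite sh_evalE.
by rewrite -sh_evalE.
Qed.

Lemma sh_is_model (B : topologicalType) D (S : sheaf_structure B D) :
  is_model (sh_valid S).
Proof.
by rewrite sh_validE; apply: soundness => mu a; exact: sh_char0_le.
Qed.

Theorem theorem6p15 (B : topologicalType) (D : Type) (D_nonempty : inhabited D) :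
  (forall S : sheaf_structure B D, is_model (sh_valid S)) /\
  (forall S : presheaf_structure B D,
     sections_over_empty S -> is_model (psh_valid S)).
Proof.
split=> S; first exact: sh_is_model.
by move=> S0; exact: psh_is_model.
Qed.
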